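(* Let $n\ge 2$ be an integer. Then $\overline{M}_n$ is a completely semisimple, combinatorial, and fundamental inverse monoid.
   Context: For an integer $n\ge 2$, $\overline{M}_n$ is the set consisting of an element $\mathbf{0}$ together with all triplets $\prec k,d,m\succ$ of real numbers $k,d,m$ satisfying $1-\min(0,d)\le k\le m\le n-\max(0,d)$. Multiplication on $\overline{M}_n$: $\mathbf{0}x=x\mathbf{0}=\mathbf{0}$ for all $x$, and for nonzero elements, $\prec k,d,m\succ\prec k',d',m'\succ$ equals $\prec k'',d'',m''\succ$ if $k''\le m''$ and equals $\mathbf{0}$ if $k''>m''$, where $k''=\max(k,k'-d)$, $d''=d+d'$, $m''=\min(m,m'-d)$. This is an inverse monoid with zero $\mathbf{0}$ and identity $\prec 1,0,n\succ$. In an inverse semigroup, the natural partial order is: $x\le y$ iff $x=ey$ for some idempotent $e$. An inverse semigroup is completely semisimple if, for all $x,y$, $x\mathcal{D}y$ and $x\le y$ imply $x=y$, where $\mathcal{D}$ is Green's relation. It is combinatorial if Green's relation $\mathcal{H}$ is the equality relation. It is fundamental if the only idempotent-separating congruence on it (a congruence that never identifies two distinct idempotents) is the equality relation. *)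

(* Defs.v *)
From mathcomp Require Import all_boot all_order all_algebra.
From mathcomp Require Import all_classical reals.
From mathcomp Require Import lra.
From Stdlib Require Import RelationClasses.

Set Implicit Arguments.
Unset Strict Implicit.
Unset Printing Implicit Defensive.

Import Order.TTheory GRing.Theory Num.Theory.
Local Open Scope classical_set_scope.
Local Open Scope ring_scope.

Section Semigroup.
Context {S : Type} (mul : S -> S -> S).

Definition semigroup_inverse (x y : S) : Prop :=
  mul (mul x y) x = x /\ mul (mul y x) y = y.

Definition inverse_monoid (one : S) : Prop :=
  [/\ associative mul, left_id one mul, right_id one mul
    & forall x, exists! y, semigroup_inverse x y].

Definition idempotent_elt (e : S) : Prop := mul e e = e.

Definition natural_le (x y : S) : Prop :=
  exists2 e, idempotent_elt e & x = mul e y.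

(* The principal ideals S^1 x and x S^1: adjoining an identity to S
   amounts to adding x itself. *)
Definition left_ideal (x : S) : set S := [set z | z = x \/ exists s, z = mul s x].
Definition right_ideal (x : S) : set S := [set z | z = x \/ exists s, z = mul x s].

Definition greenL (x y : S) : Prop := left_ideal x = left_ideal y.
Definition greenR (x y : S) : Prop := right_ideal x = right_ideal y.
Definition greenH (x y : S) : Prop := greenL x y /\ greenR x y.
(* D is the composite of L and R; these commute in every semigroup, so D is
   also their join. *)
Definition greenD (x y : S) : Prop := exists2 z, greenL x z & greenR z y.

Definition completely_semisimple : Prop :=
  forall x y, greenD x y -> natural_le x y -> x = y.

Definition combinatorial : Prop := forall x y, greenH x y <-> x = y.

Definition congruence (rho : S -> S -> Prop) : Prop :=
  Equivalence rho /\
  forall x x' y y', rho x x' -> rho y y' -> rho (mul x y) (mul x' y').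

Definition idempotent_separating (rho : S -> S -> Prop) : Prop :=
  forall e f, idempotent_elt e -> idempotent_elt f -> rho e f -> e = f.

Definition fundamental : Prop :=
  forall rho, congruence rho -> idempotent_separating rho ->
    forall x y, rho x y <-> x = y.

End Semigroup.

Section Mbar.
Context {R : realType} {n : nat}.

Definition admissible (k d m : R) : bool :=
  [&& 1 - Num.min 0 d <= k, k <= m & m <= n%:R - Num.max 0 d].

Inductive Mbar : Type :=
| Zero
| Triplet (k d m : R) of admissible k d m.

Lemma admissible_mul (k d m k' d' m' : R) :
  admissible k d m -> admissible k' d' m' ->
  Num.max k (k' - d) <= Num.min m (m' - d) ->
  admissible (Num.max k (k' - d)) (d + d') (Num.min m (m' - d)).
Proof.
rewrite /admissible => /and3P[hk _ hm] /and3P[hk' _ hm'] ->; rewrite andTb.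
move: hk hm hk' hm'; rewrite !minEle !maxEle.
case: (leP 0 d); case: (leP 0 d'); case: (leP 0 (d + d'));
  case: (leP k (k' - d)); case: (leP m (m' - d)) => *; apply/andP; split; lra.
Qed.

Definition Mbar_mul (x y : Mbar) : Mbar :=
  match x, y with
  | Triplet k d m hx, Triplet k' d' m' hy =>
      match @idP (Num.max k (k' - d) <= Num.min m (m' - d)) with
      | ReflectT h => Triplet (admissible_mul hx hy h)
      | ReflectF _ => Zero
      end
  | _, _ => Zero
  end.

Lemma admissible_one : (2 <= n)%N -> admissible 1 0 n%:R.
Proof.
by move=> hn; rewrite /admissible minxx maxxx !subr0 !lexx ler1n (ltnW hn).
Qed.

Definition Mbar_one (hn : (2 <= n)%N) : Mbar := Triplet (admissible_one hn).

End Mbar.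

Arguments Mbar R n : clear implicits.

(* Main.v *)
Require Import Defs.
From mathcomp Require Import all_boot all_order all_algebra.
From mathcomp Require Import all_classical reals.
From mathcomp Require Import lra.
From Stdlib Require Import RelationClasses.

(** The triplet [Triplet k d m] is the code of a partial translation of the
real line: the map sending [a] to [a + d], restricted to the closed interval
[[k, m]]. Admissibility says that this interval is nonempty and that it and
its translate by [d] lie in [[1, n]]; the product of triplets is composition
of partial maps (written left to right), and [Zero] is the empty map. The
relation [act x] is the graph of the partial map coded by [x]. Since a
nonempty translation determines its domain and its displacement, [act] is
injective ([act_inj]), so that it embeds the monoid into the symmetric inverse
monoid of the line, and each claim becomes one about graphs.

- Associativity is that of composition. Partial maps being injective, the
  equations [xyx = x] and [yxy = y] force the graph of [y] to be the converse
  of the graph of [x], which is the graph of the opposite translation.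
- Related elements for L have the same range, for R the same domain
  ([greenL_ran], [greenR_dom]). Thus H-related triplets have the same domain
  and the same range, hence the same displacement, and D-related triplets have
  domains of the same length. If moreover [x <= y], then [x] is a restriction
  of [y] ([natural_le_act]), and an interval has no proper closed subinterval
  of its own length.
- An idempotent-separating congruence cannot identify a nonzero [x] with
  [Zero]: the idempotent [x x^-1] would be identified with [Zero] too. But
  whether [a] is sent to [b] by [x] can be read from the vanishing of
  [e_a x e_b], where [e_a] is the identity of the one-point interval [[a, a]].
  Congruent elements therefore have the same graph. *)

Set Implicit Arguments.
Unset Strict Implicit.
Unset Printing Implicit Defensive.

Import Order.TTheory GRing.Theory Num.Theory.
Local Open Scope ring_scope.

Lemma interval_inj (R : realDomainType) (k m k' m' : R) :
  k <= m -> k' <= m' ->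
  (forall a, k <= a <= m <-> k' <= a <= m') -> k = k' /\ m = m'.
Proof.
move=> km km' E.
have /andP[] : k' <= k <= m' by apply/E; rewrite lexx.
have /andP[] : k' <= m <= m' by apply/E; rewrite km lexx.
have /andP[] : k <= k' <= m by apply/E; rewrite lexx.
have /andP[] : k <= m' <= m by apply/E; rewrite km' lexx.
by move=> *; split; lra.
Qed.

(** * Triplets as partial translations *)

Section PartialTranslations.
Context {R : realType} {n : nat}.
Notation M := (Mbar R n).
Notation mul := (@Mbar_mul R n).
Implicit Types (x y z e : M) (a b c : R).

(** The minimum and the maximum in the definition of admissibility encode, in
one bound each, the constraints on an interval and on its translate. *)
Lemma admissibleP (k d m : R) :
  reflect [/\ 1 <= k, 1 <= k + d, k <= m, m <= n%:R & m + d <= n%:R]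
          (admissible (n := n) k d m).
Proof.
rewrite /admissible minEle maxEle.
by case: (leP 0 d) => hd; apply: (iffP and3P) => -[*]; split; lra.
Qed.

Definition act x a b : Prop :=
  if x is Triplet k d m _ then k <= a <= m /\ b = a + d else False.

Lemma Triplet_eq (k d m k' d' m' : R) (h : admissible (n := n) k d m)
    (h' : admissible (n := n) k' d' m') :
  k = k' -> d = d' -> m = m' -> Triplet h = Triplet h'.
Proof.
by move=> ek ed em; subst k' d' m'; rewrite (bool_irrelevance h h').
Qed.

Lemma act_functional x a b c : act x a b -> act x a c -> b = c.
Proof. by case: x => //= k d m _ [_ ->] [_ ->]. Qed.

Lemma act_injective x a b c : act x a c -> act x b c -> a = b.
Proof. by case: x => //= k d m _ [_ ->] [_ /addIr]. Qed.

Lemma act_bounds x a b :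
  act x a b -> (1 <= a <= n%:R) && (1 <= b <= n%:R).
Proof.
case: x => //= k d m /admissibleP[? ? ? ? ?] [/andP[? ?] ->].
by apply/andP; split; apply/andP; split; lra.
Qed.

(** The endpoints [k' - d] and [m' - d] are the translates back by [d] of those
of the second domain: the product is [Zero] exactly when no point of the first
range lies in the second domain. *)
Lemma act_mul x y a c :
  act (mul x y) a c <-> exists2 b, act x a b & act y b c.
Proof.
case: x => [|k d m hx] /=; first by split=> // -[].
case: y => [|k' d' m' hy] /=; first by split=> // -[].
case: {-}_ / idP => [h|nh] /=.
- rewrite ge_max le_min; split.
  + case=> /andP[/andP[? ?] /andP[? ?]] ->.
    by exists (a + d); split; [apply/andP; split; lra|lra
      |apply/andP; split; lra|lra].
  + case=> b [/andP[? ?] ->] [/andP[? ?] ->].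
    by split; [apply/andP; split; apply/andP; split; lra|lra].
- split=> // -[b [/andP[? ?] ->] [/andP[? ?] _]]; apply: nh.
  by apply: (@le_trans _ _ a); rewrite ?ge_max ?le_min;
    apply/andP; split; lra.
Qed.

Lemma act_Triplet0 (k d m : R) (h : admissible (n := n) k d m) :
  act (Triplet h) k (k + d).
Proof. by case/admissibleP: (h) => _ _ km _ _ /=; rewrite lexx. Qed.

Lemma act_eq0 x : (forall a b, ~ act x a b) -> x = Zero.
Proof. by case: x => // k d m h /(_ _ _ (act_Triplet0 h)). Qed.

(** A nonempty graph contains its left end [(k, k + d)], which reveals the
displacement; the endpoints are then those of the domain. On the empty graph
[d] would not be determined, which is why there is a single [Zero]. *)
Lemma act_inj x y : (forall a b, act x a b <-> act y a b) -> x = y.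
Proof.
case: x => [|k d m h] E.
  by rewrite (act_eq0 (x := y)) // => a b /E.
case: y E => [|k' d' m' h'] E; first by have /E := act_Triplet0 h.
have ed : d = d'.
  by have /E[_ /addrI] := act_Triplet0 h.
have [_ _ km _ _] := admissibleP _ _ _ h.
have [_ _ km' _ _] := admissibleP _ _ _ h'.
have [//|ek em] := @interval_inj _ k m k' m' km km'.
  move=> a; split=> ha.
    by have /E[] : act (Triplet h) a (a + d) by [].
  by have /E[] : act (Triplet h') a (a + d') by [].
exact: Triplet_eq.
Qed.

(** * The inverse monoid structure *)

Lemma Mbar_mulA : associative mul.
Proof.
move=> x y z; apply: act_inj => a d; split.
- case/act_mul=> b xab /act_mul[c ybc zcd].
  by apply/act_mul; exists c => //; apply/act_mul; exists b.
- case/act_mul=> c /act_mul[b xab ybc] zcd.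
  by apply/act_mul; exists b => //; apply/act_mul; exists c.
Qed.

Lemma act_one (hn : (2 <= n)%N) a b :
  act (Mbar_one hn) a b <-> 1 <= a <= n%:R /\ b = a.
Proof. by rewrite /= addr0. Qed.

Lemma Mbar_mul1 (hn : (2 <= n)%N) : left_id (Mbar_one hn) mul.
Proof.
move=> x; apply: act_inj => a b; split.
- by case/act_mul=> c /act_one[_ ->].
- move=> xab; apply/act_mul; exists a => //; apply/act_one.
  by case/andP: (act_bounds xab).
Qed.

Lemma Mbar_mulr1 (hn : (2 <= n)%N) : right_id (Mbar_one hn) mul.
Proof.
move=> x; apply: act_inj => a b; split.
- by case/act_mul=> c xac /act_one[_ ->].
- move=> xab; apply/act_mul; exists b => //; apply/act_one.
  by case/andP: (act_bounds xab).
Qed.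

Lemma act_converse_ex x : exists y, forall a b, act y a b <-> act x b a.
Proof.
case: x => [|k d m h]; first by exists Zero.
have h' : admissible (n := n) (k + d) (- d) (m + d).
  by case/admissibleP: h => *; apply/admissibleP; split; lra.
exists (Triplet h') => a b /=.
by split=> -[/andP[? ?] ->]; (split; [apply/andP; split; lra|lra]).
Qed.

Lemma semigroup_inverse_sym x y :
  semigroup_inverse mul x y -> semigroup_inverse mul y x.
Proof. by case. Qed.

(** In [xyx = x], the only path that can lead from [a] to [b] goes from [a] to
[b], back to [a], and to [b] again. *)
Lemma semigroup_inverse_act x y a b :
  semigroup_inverse mul x y -> act x a b -> act y b a.
Proof.
case=> xyx _ xab; have := xab; rewrite -{1}xyx.
case/act_mul=> c /act_mul[b' xab' yb'c] xcb.
by rewrite (act_functional xab xab') (act_injective xab xcb).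
Qed.

Lemma semigroup_inverseP x y :
  semigroup_inverse mul x y <-> forall a b, act y a b <-> act x b a.
Proof.
have sub z t : (forall a b, act t a b <-> act z b a) ->
    mul (mul z t) z = z.
  move=> E; apply: act_inj => a b; split.
  - case/act_mul=> c /act_mul[b' zab' /E zcb'] zcb.
    by rewrite (act_injective zab' zcb').
  - move=> zab; apply/act_mul; exists a => //.
    by apply/act_mul; exists b => //; apply/E.
split=> [xy a b|E].
- split; first exact: (semigroup_inverse_act (semigroup_inverse_sym xy)).
  exact: semigroup_inverse_act.
- by split; apply: sub => // a b; split=> /E.
Qed.

Lemma Mbar_inverse_monoid (hn : (2 <= n)%N) :
  inverse_monoid mul (Mbar_one hn).
Proof.
split; [exact: Mbar_mulA|exact: Mbar_mul1|exact: Mbar_mulr1|move=> x].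
have [y E] := act_converse_ex x; exists y; split.
  exact/semigroup_inverseP.
move=> z /semigroup_inverseP E'; apply: act_inj => a b.
by rewrite E E'.
Qed.

(** * The natural order and Green's relations *)

(** If [e] sends [a] to [b], then [ee = e] splits this step in two steps of
[e]; the first one forces the middle point to be [b], the second one to be
[a]. *)
Lemma idempotent_act e a b : idempotent_elt mul e -> act e a b -> a = b.
Proof.
move=> ee eab; have := eab; rewrite -{1}ee => /act_mul[c eac ecb].
by rewrite (act_functional eab eac) (act_injective eab ecb).
Qed.

Lemma natural_le_act x y a b : natural_le mul x y -> act x a b -> act y a b.
Proof.
by case=> e ee -> /act_mul[c /(idempotent_act ee) <-].
Qed.

(** Left multiplication can only shrink the range. *)
Lemma greenL_ran x y b : greenL mul x y ->
  (exists a, act x a b) <-> (exists a, act y a b).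
Proof.
have sub z t : left_ideal mul t z ->
    (exists a, act z a b) -> (exists a, act t a b).
  by case=> [->//|[s ->]] [a /act_mul[c _ tcb]]; exists c.
by move=> E; split; apply: sub; [rewrite -E|rewrite E]; left.
Qed.

(** Right multiplication can only shrink the domain. *)
Lemma greenR_dom x y a : greenR mul x y ->
  (exists b, act x a b) <-> (exists b, act y a b).
Proof.
have sub z t : right_ideal mul t z ->
    (exists b, act z a b) -> (exists b, act t a b).
  by case=> [->//|[s ->]] [b /act_mul[c tac _]]; exists c.
by move=> E; split; apply: sub; [rewrite -E|rewrite E]; left.
Qed.

Lemma Zero_or_nonempty x : x = Zero \/ exists a b, act x a b.
Proof.
case: x => [|k d m h]; first by left.
by right; exists k, (k + d); apply: act_Triplet0.
Qed.

Lemma greenL_Zero x y : greenL mul x y -> x = Zero <-> y = Zero.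
Proof.
have sub z t : greenL mul z t -> z = Zero -> t = Zero.
  move=> E z0; apply: act_eq0 => a b tab.
  by have [] := (greenL_ran b E).2 (ex_intro _ a tab); rewrite z0.
by move=> E; split; apply: sub.
Qed.

Lemma greenR_Zero x y : greenR mul x y -> x = Zero <-> y = Zero.
Proof.
have sub z t : greenR mul z t -> z = Zero -> t = Zero.
  move=> E z0; apply: act_eq0 => a b tab.
  by have [] := (greenR_dom a E).2 (ex_intro _ b tab); rewrite z0.
by move=> E; split; apply: sub.
Qed.

Lemma greenL_Triplet (k d m k' d' m' : R) (h : admissible (n := n) k d m)
    (h' : admissible (n := n) k' d' m') :
  greenL mul (Triplet h) (Triplet h') -> k + d = k' + d' /\ m + d = m' + d'.
Proof.
move=> E; have [_ _ km _ _] := admissibleP _ _ _ h.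
have [_ _ km' _ _] := admissibleP _ _ _ h'.
have ranE k1 d1 m1 (h1 : admissible (n := n) k1 d1 m1) b :
    k1 + d1 <= b <= m1 + d1 <-> exists a, act (Triplet h1) a b.
  split=> [/andP[? ?]|[a [/andP[? ?] ->]]]; last by apply/andP; split; lra.
  by exists (b - d1); split; [apply/andP; split; lra|lra].
apply: interval_inj => [||b]; [by rewrite lerD2r|by rewrite lerD2r|].
by split=> /ranE/(greenL_ran b E)/ranE.
Qed.

Lemma greenR_Triplet (k d m k' d' m' : R) (h : admissible (n := n) k d m)
    (h' : admissible (n := n) k' d' m') :
  greenR mul (Triplet h) (Triplet h') -> k = k' /\ m = m'.
Proof.
move=> E; have [_ _ km _ _] := admissibleP _ _ _ h.
have [_ _ km' _ _] := admissibleP _ _ _ h'.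
have domE k1 d1 m1 (h1 : admissible (n := n) k1 d1 m1) a :
    k1 <= a <= m1 <-> exists b, act (Triplet h1) a b.
  by split=> [?|[b []]//]; exists (a + d1).
by apply: interval_inj => // a; split=> /domE/(greenR_dom a E)/domE.
Qed.

(** The intermediate element [z] has the range of [x] and the domain of [y], so
that [m - k] has the same value for the three of them; as [x] is a restriction
of [y], the endpoints agree. *)
Lemma Mbar_completely_semisimple : completely_semisimple mul.
Proof.
move=> x y [z xLz zRy] xy.
case: x xLz xy => [|k d m h] xLz xy.
  by apply/esym/(greenR_Zero zRy)/(greenL_Zero xLz).
case: y zRy xy => [|k' d' m' h'] zRy xy.
  by apply/(greenL_Zero xLz)/(greenR_Zero zRy).
case: z xLz zRy => [|k1 d1 m1 h1] xLz zRy.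
  by have := (greenL_Zero xLz).2 erefl.
have [ek1 em1] := greenL_Triplet xLz.
have [ek2 em2] := greenR_Triplet zRy.
have [_ _ km _ _] := admissibleP _ _ _ h.
have [/andP[k'k _] /addrI ed] := natural_le_act xy (act_Triplet0 h).
have [/andP[_ mm'] _] : act (Triplet h') m (m + d).
  by apply: (natural_le_act xy); rewrite /= lexx km.
by apply: Triplet_eq; lra.
Qed.

Lemma Mbar_combinatorial : combinatorial mul.
Proof.
move=> x y; split=> [[xLy xRy]|->]; last by [].
case: x xLy xRy => [|k d m h] xLy xRy; first exact/esym/(greenL_Zero xLy).
case: y xLy xRy => [|k' d' m' h'] xLy xRy; first exact/(greenL_Zero xLy).
have [ekd _] := greenL_Triplet xLy; have [ek em] := greenR_Triplet xRy.
by apply: Triplet_eq; lra.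
Qed.

(** * Idempotent-separating congruences *)

Lemma point_idempotent_ex a : 1 <= a <= n%:R ->
  exists e, forall b c, act e b c <-> b = a /\ c = a.
Proof.
case/andP=> a1 an.
have h : admissible (n := n) a 0 a by apply/admissibleP; split; lra.
exists (Triplet h) => b c /=; rewrite addr0.
by split=> [[/le_anti <- ->]|[-> ->]]; rewrite ?lexx.
Qed.

(** Multiplying by the inverse [y] of [x] carries the hypothesis to the
idempotents [xy] and [Zero]. *)
Lemma idempotent_separating_Zero (rho : M -> M -> Prop) x :
  congruence mul rho -> idempotent_separating mul rho ->
  rho x Zero -> x = Zero.
Proof.
move=> [eqv cong] sep x0; have [y /semigroup_inverseP[xyx _]] :=
  act_converse_ex x.
have xy0 : mul x y = Zero.
  apply: sep => //; first by rewrite /idempotent_elt Mbar_mulA xyx.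
  by apply: (cong _ _ _ _ x0 (Equivalence_Reflexive y)).
by rewrite -xyx xy0.
Qed.

(** That [a] is sent to [b] by [z] is expressed by [e_a z e_b] being nonzero, a
condition that depends only on the class of [z], because the class of [Zero]
is a singleton. *)
Lemma Mbar_fundamental : fundamental mul.
Proof.
move=> rho cg sep x y; have [eqv cong] := cg.
split=> [|->]; last exact: Equivalence_Reflexive.
have sub z t a b : rho z t -> act z a b -> act t a b.
  move=> zt zab; have /andP[ha hb] := act_bounds zab.
  have [ea Ea] := point_idempotent_ex ha.
  have [eb Eb] := point_idempotent_ex hb.
  have act_sandwich w c d : act (mul (mul ea w) eb) c d -> act w a b.
    by case/act_mul=> b' /act_mul[a' /Ea[_ ->] waz] /Eb[<- _].
  have [t0|[c [d]]] := Zero_or_nonempty (mul (mul ea t) eb);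
    last exact: act_sandwich.
  have z0 : mul (mul ea z) eb = Zero.
    apply: (idempotent_separating_Zero cg sep); rewrite -t0.
    by apply: (cong) => //; last exact: Equivalence_Reflexive;
      apply: (cong) => //; exact: Equivalence_Reflexive.
  have : act (mul (mul ea z) eb) a b.
    apply/act_mul; exists b; last exact/Eb.
    by apply/act_mul; exists a => //; apply/Ea.
  by rewrite z0.
move=> xy; apply: act_inj => a b.
by split; apply: sub => //; apply: Equivalence_Symmetric.
Qed.

End PartialTranslations.

Theorem corollary6 (R : realType) (n : nat) (hn : (2 <= n)%N) :
  [/\ inverse_monoid (@Mbar_mul R n) (Mbar_one hn),
      completely_semisimple (@Mbar_mul R n),
      combinatorial (@Mbar_mul R n)
    & fundamental (@Mbar_mul R n)].
Proof.
split.
- exact: Mbar_inverse_monoid.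
- exact: Mbar_completely_semisimple.
- exact: Mbar_combinatorial.
- exact: Mbar_fundamental.
Qed.
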